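(* Let $D$ be a valuation domain. The following assertions are equivalent: (a) $D$ is sharp. (b) $D$ is pseudo-Dedekind. (c) The value group of $D$ is a complete subgroup of the reals. In particular, a sharp valuation domain has (Krull) dimension $\leq 1$.
   Context: All rings are integral domains (commutative, unitary, without zero-divisors). A domain $D$ is called a sharp domain if whenever $I \supseteq AB$ with $I, A, B$ nonzero ideals of $D$, there exist ideals $A' \supseteq A$ and $B' \supseteq B$ of $D$ such that $I = A'B'$. Let $K$ be the quotient field of $D$. For a nonzero fractional ideal $I$ of $D$, put $I^{-1} = \{x \in K \mid xI \subseteq D\}$; the $v$-closure of $I$ is $I_v = (I^{-1})^{-1}$. A domain $D$ is pseudo-Dedekind if the $v$-closure of each nonzero ideal of $D$ is invertible. The value group of a valuation domain ''is a complete subgroup of the reals'' means that it is isomorphic, as an ordered abelian group, to a subgroup of $(\mathbb{R},+)$ in which every nonempty subset bounded below has an infimum (in that subgroup); equivalently, it is order-isomorphic to $0$, $\mathbb{Z}$ or $\mathbb{R}$. A field is regarded as a valuation domain with trivial value group $0$. *)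

(* Defs.v *)
From HB Require Import structures.
From mathcomp Require Import all_boot all_order all_algebra.
From mathcomp Require Import boolp classical_sets functions reals.

Set Implicit Arguments.
Unset Strict Implicit.
Unset Printing Implicit Defensive.

Import Order.TTheory GRing.Theory Num.Theory.
Local Open Scope classical_set_scope.
Local Open Scope quotient_scope.
Local Open Scope ring_scope.

(* The library's ideals (ring_quotient) are proper by definition; here the unit
   ideal must be allowed. *)
Definition ideal (D : idomainType) (I : set D) : Prop :=
  [/\ I 0, forall x y, I x -> I y -> I (x + y)
         & forall a x, I x -> I (a * x)].

Definition nonzero (V : zmodType) (I : set V) : Prop :=
  exists2 x, I x & x != 0.

(* All finite sums of products a * b with a in A and b in B; used both for
   ideals of D and for D-submodules of the quotient field. *)
Definition ideal_mul (T : nzRingType) (A B : set T) : set T :=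
  [set x | exists n (a b : 'I_n -> T),
    [/\ forall i, A (a i), forall i, B (b i) & x = \sum_(i < n) a i * b i]].

Definition sharp (D : idomainType) : Prop :=
  forall I A B : set D,
    ideal I -> ideal A -> ideal B -> nonzero I -> nonzero A -> nonzero B ->
    ideal_mul A B `<=` I ->
    exists A' B' : set D,
      [/\ ideal A', ideal B', A `<=` A', B `<=` B' & I = ideal_mul A' B'].

Definition prime_ideal (D : idomainType) (P : set D) : Prop :=
  [/\ ideal P, ~ P 1 & forall x y, P (x * y) -> P x \/ P y].

(* Every chain P 0 < P 1 < ... < P m of prime ideals has m <= n; the values of
   P beyond m are irrelevant. *)
Definition krull_dim_le (D : idomainType) (n : nat) : Prop :=
  forall (m : nat) (P : nat -> set D),
    (forall i, (i <= m)%N -> prime_ideal (P i)) ->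
    (forall i, (i < m)%N -> P i `<` P i.+1) ->
    (m <= n)%N.

Notation "x %:F" := (@FracField.tofrac _ x) : ring_scope.

Section QuotientField.
Variable D : idomainType.
Local Notation K := {fraction D}.
Implicit Types (I J : set K) (x y z : K).

Definition base : set K := range (@FracField.tofrac D).

Definition valuation_domain : Prop :=
  forall x, x != 0 -> base x \/ base x^-1.

Definition fractional_ideal I : Prop :=
  [/\ I 0, forall x y, I x -> I y -> I (x + y),
      forall a x, base a -> I x -> I (a * x)
    & exists2 d : D, d != 0 & forall x, I x -> base (d%:F * x)].

Definition frac_inv I : set K := [set x | forall y, I y -> base (x * y)].

Definition v_closure I : set K := frac_inv (frac_inv I).

Definition invertible I : Prop :=
  exists2 J, fractional_ideal J & ideal_mul I J = base.

Definition pseudo_Dedekind : Prop :=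
  forall I : set D, ideal I -> nonzero I ->
    invertible (v_closure (@FracField.tofrac D @` I)).

Lemma base1 : base 1. Proof. by exists 1 => //; rewrite rmorph1. Qed.
Lemma baseM x y : base x -> base y -> base (x * y).
Proof. by move=> [a _ <-] [b _ <-]; exists (a * b) => //; rewrite rmorphM. Qed.

(* The value group K^* / U(D), written additively and ordered by
   v(x) <= v(y) iff y / x is in D.  The construction makes sense for every
   domain; the order is total exactly when D is a valuation domain. *)
Definition frac_units := {x : K | x != 0}.
HB.instance Definition _ := SubChoice.on frac_units.
Implicit Types u v w : frac_units.

Definition fu1 : frac_units := exist _ 1 (oner_neq0 K).
Fact fu_neq0 u : val u != 0.
Proof. exact: (valP u). Qed.
Fact fu_mul_neq0 u v : val u * val v != 0.
Proof. exact: mulf_neq0 (fu_neq0 u) (fu_neq0 v). Qed.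
Definition fu_mul u v : frac_units := exist _ (val u * val v) (fu_mul_neq0 u v).
Fact fu_inv_neq0 u : (val u)^-1 != 0.
Proof. by rewrite invr_neq0 // fu_neq0. Qed.
Definition fu_inv u : frac_units := exist _ (val u)^-1 (fu_inv_neq0 u).

Definition dvdF u v : bool := `[< base (val v / val u) >].
Definition assocF u v : bool :=
  `[< exists2 e : D, e \is a GRing.unit & val v / val u = e%:F >].

Lemma dvdF_refl u : dvdF u u.
Proof. by apply/asboolP; rewrite divff ?fu_neq0//; exact: base1. Qed.

Lemma dvdF_trans v u w : dvdF u v -> dvdF v w -> dvdF u w.
Proof.
move=> /asboolP uv /asboolP vw; apply/asboolP.
have -> : val w / val u = (val w / val v) * (val v / val u).
  by rewrite mulrA divfK ?fu_neq0.
exact: baseM.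
Qed.

Lemma assocFE u v : assocF u v = dvdF u v && dvdF v u.
Proof.
have u0 := fu_neq0 u; have v0 := fu_neq0 v.
apply/asboolP/andP => [[e Ue E]|[/asboolP[a _ E] /asboolP[b _ E']]].
  split; apply/asboolP; first by exists e.
  exists e^-1 => //; apply: (mulfI (fu_mul_neq0 v (fu_inv u))) => /=.
  rewrite [in LHS]E -rmorphM divrr// rmorph1.
  by rewrite mulrA divfK// divff.
exists a; last by [].
apply/unitrPr; exists b; apply/eqP; rewrite -tofrac_eq tofracM tofrac1 E E'.
by rewrite mulrA divfK// divff.
Qed.

Lemma assocF_refl : reflexive assocF.
Proof. by move=> u; rewrite assocFE dvdF_refl. Qed.
Lemma assocF_sym : symmetric assocF.
Proof. by move=> u v; rewrite !assocFE andbC. Qed.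
Lemma assocF_trans : transitive assocF.
Proof.
move=> v u w; rewrite !assocFE => /andP[uv vu] /andP[vw wv].
by rewrite (dvdF_trans uv vw) (dvdF_trans wv vu).
Qed.

Canonical assocF_equiv := EquivRel assocF assocF_refl assocF_sym assocF_trans.

Definition value_group := {eq_quot assocF}.
HB.instance Definition _ : EqQuotient _ assocF value_group :=
  EqQuotient.on value_group.
HB.instance Definition _ := Choice.on value_group.

Definition vg0 : value_group := \pi_value_group fu1.
Definition vg_opp (g : value_group) : value_group := \pi_value_group (fu_inv (repr g)).
Definition vg_add (g h : value_group) : value_group :=
  \pi_value_group (fu_mul (repr g) (repr h)).
Definition vg_le (g h : value_group) : bool := dvdF (repr g) (repr h).

Lemma dvdF_repr u : dvdF u (repr (\pi_value_group u)) /\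
                    dvdF (repr (\pi_value_group u)) u.
Proof.
by apply/andP; rewrite -assocFE; apply/(@eqquotP _ assocF value_group);
  rewrite reprK.
Qed.

Lemma dvdF_mul u u' v v' :
  dvdF u u' -> dvdF v v' -> dvdF (fu_mul u v) (fu_mul u' v').
Proof.
move=> /asboolP h /asboolP k; apply/asboolP => /=.
by rewrite invfM mulrACA; exact: baseM.
Qed.

Lemma dvdF_inv u v : dvdF u v -> dvdF (fu_inv v) (fu_inv u).
Proof. by move=> /asboolP h; apply/asboolP => /=; rewrite invrK mulrC. Qed.

Lemma eq_pi u v : dvdF u v -> dvdF v u -> \pi_value_group u = \pi_value_group v.
Proof.
by move=> uv vu; apply/(@eqquotP _ assocF value_group); rewrite /= assocFE uv.
Qed.

Lemma vg_addE u v :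
  vg_add (\pi_value_group u) (\pi_value_group v) = \pi_value_group (fu_mul u v).
Proof.
have [a b] := dvdF_repr u; have [c d] := dvdF_repr v.
by apply: eq_pi; exact: dvdF_mul.
Qed.

Lemma vg_oppE u : vg_opp (\pi_value_group u) = \pi_value_group (fu_inv u).
Proof. by have [a b] := dvdF_repr u; apply: eq_pi; exact: dvdF_inv. Qed.

Lemma vg_leE u v : vg_le (\pi_value_group u) (\pi_value_group v) = dvdF u v.
Proof.
have [a b] := dvdF_repr u; have [c d] := dvdF_repr v.
apply/idP/idP => h; first by apply: dvdF_trans d; exact: dvdF_trans h.
by apply: dvdF_trans c; exact: dvdF_trans h.
Qed.

Fact vg_addA : associative vg_add.
Proof.
elim/quotW => u; elim/quotW => v; elim/quotW => w.
rewrite (vg_addE v w) (vg_addE u) (vg_addE u v) (vg_addE _ w).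
by congr (\pi_value_group _); apply: val_inj; rewrite /= mulrA.
Qed.
Fact vg_addC : commutative vg_add.
Proof.
elim/quotW => u; elim/quotW => v.
rewrite (vg_addE u v) (vg_addE v u).
by congr (\pi_value_group _); apply: val_inj; rewrite /= mulrC.
Qed.
Fact vg_add0 : left_id vg0 vg_add.
Proof.
elim/quotW => u; rewrite vg_addE.
by congr (\pi_value_group _); apply: val_inj; rewrite /= mul1r.
Qed.
Fact vg_addN : left_inverse vg0 vg_opp vg_add.
Proof.
elim/quotW => u; rewrite vg_oppE vg_addE.
by congr (\pi_value_group _); apply: val_inj; rewrite /= mulVf ?fu_neq0.
Qed.
HB.instance Definition _ :=
  GRing.isZmodule.Build value_group vg_addA vg_addC vg_add0 vg_addN.

Fact vg_le_refl : reflexive vg_le.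
Proof. by move=> g; exact: dvdF_refl. Qed.
Fact vg_le_anti : antisymmetric vg_le.
Proof. by move=> g h /andP[gh hg]; rewrite -[g]reprK -[h]reprK; exact: eq_pi. Qed.
Fact vg_le_trans : transitive vg_le.
Proof. by move=> h g k; exact: dvdF_trans. Qed.
HB.instance Definition _ :=
  Order.Le_isPOrder.Build ring_display value_group
    vg_le_refl vg_le_anti vg_le_trans.

Lemma value_group_leE u v :
  (\pi_value_group u <= \pi_value_group v) = `[< base (val v / val u) >].
Proof. exact: vg_leE. Qed.

Lemma value_group_addE u v :
  \pi_value_group u + \pi_value_group v = \pi_value_group (fu_mul u v).
Proof. exact: vg_addE. Qed.

Lemma value_group_leD (g h k : value_group) : g <= h -> g + k <= h + k.
Proof.
elim/quotW: g => u; elim/quotW: h => v; elim/quotW: k => w.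
rewrite (value_group_addE u w) (value_group_addE v w) !value_group_leE.
by move=> uv; exact: dvdF_mul uv (dvdF_refl w).
Qed.

Lemma value_group_total :
  valuation_domain <-> total (<=%R : rel value_group).
Proof.
split=> [Dval|tot x x0].
  elim/quotW => u; elim/quotW => v; rewrite !value_group_leE; apply/orP.
  have [h|h] := Dval (val v / val u) (fu_mul_neq0 v (fu_inv u)).
    by left; apply/asboolP.
  by right; apply/asboolP; rewrite -[_ / _]invrK invfM invrK mulrC.
have := tot (\pi_value_group fu1) (\pi_value_group (exist _ x x0)).
rewrite !value_group_leE /= invr1 mulr1 mul1r.
by move=> /orP[/asboolP|/asboolP]; [left|right].
Qed.

End QuotientField.

Definition real_subgroup (R : realType) (G : set R) : Prop :=
  G 0 /\ forall x y, G x -> G y -> G (x - y).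

(* Lower bounds and infima are taken inside G. *)
Definition complete_in (R : realType) (G : set R) : Prop :=
  forall S : set R, S `<=` G -> S !=set0 -> G `&` lbound S !=set0 ->
    exists m, (G `&` lbound S) m /\ ubound (G `&` lbound S) m.

Definition value_group_complete_real (R : realType) (D : idomainType) : Prop :=
  exists G : set R, [/\ real_subgroup G, complete_in G
    & exists phi : {additive value_group D -> R},
        set_bij [set: value_group D] G phi /\ {mono phi : g h / g <= h}].

(* Main.v *)
Require Import Defs.
From HB Require Import structures.
From mathcomp Require Import all_boot all_order all_algebra.
From mathcomp Require Import boolp classical_sets functions reals.
From mathcomp Require Import ring lra zify.

Set Implicit Arguments.
Unset Strict Implicit.
Unset Printing Implicit Defensive.

Import Order.TTheory GRing.Theory Num.Theory.
Local Open Scope classical_set_scope.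
Local Open Scope ring_scope.

(** For a valuation domain [D] the three conditions are compared through a
    fourth one: every nonzero ideal [I] has a greatest common divisor [a] in
    [D], that is, [aD] is the least principal ideal containing [I].

    The value of [a] is then the infimum of the values of [I], and every set of
    values that is bounded below is, up to translation and upward closure, the
    value set of an ideal; so greatest common divisors exist exactly when the
    value group is conditionally complete ([complete_gcd], [gcd_complete]).  A
    conditionally complete totally ordered group is archimedean
    ([conditionally_complete_archimedean]), so by Hoelder's theorem
    ([hoelder_embedding]) it embeds in the reals; completeness, being a property
    of the order, passes to the image and back
    ([value_group_complete_realP]).

    The remaining implications form a cycle.  If [D] is sharp and [x] is a
    nonzero element of [I], a sharp factorization of [xD] above
    [I * (x I^-1)] exhibits the divisorial closure of [I] as a factor of a
    principal ideal, hence as invertible ([sharp_pseudo_Dedekind]).  Since [D]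
    is local, an invertible ideal is principal, and a generator of the
    divisorial closure of [I] is a greatest common divisor of [I]
    ([pseudo_Dedekind_gcd]).  Finally, given [A * B <= I], a principal factor
    [dD] of [I] can be chosen with [d] the greatest common divisor of [A] or an
    element of [B] of least value, the other factor being the quotient of [I]
    by [d] ([gcd_sharp]).

    An archimedean value group leaves no room for two nonzero prime ideals, one
    strictly inside the other ([archimedean_krull_dim]). *)

(** * Totally ordered abelian groups *)

Definition conditionally_complete (G : porderZmodType) : Prop :=
  forall S : set G, S !=set0 -> lbound S !=set0 ->
    exists m, lbound S m /\ ubound (lbound S) m.

Definition archimedean_group (G : porderZmodType) : Prop :=
  forall g e : G, 0 < e -> exists n, g <= e *+ n.

Section OrderedGroup.
Variable G : porderZmodType.
Hypothesis le_total : total (<=%R : rel G).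
Hypothesis leD : forall g h k : G, g <= h -> g + k <= h + k.
Implicit Types g h k e : G.

Lemma group_leP g h : ~ g <= h -> h < g.
Proof.
move=> /negP gh; have := le_total g h; rewrite (negbTE gh) /= lt_neqAle => hg.
by rewrite hg andbT; apply: contraNneq gh => ->.
Qed.

Lemma group_lerD g h k l : g <= h -> k <= l -> g + k <= h + l.
Proof.
move=> gh kl; apply: (le_trans (leD k gh)).
by rewrite ![h + _]addrC; exact: leD.
Qed.

Lemma group_lerMn n g h : g <= h -> g *+ n <= h *+ n.
Proof.
by move=> gh; elim: n => [|n IHn]; rewrite ?mulr0n// !mulrS group_lerD.
Qed.

Lemma group_subr_ge0 g h : (0 <= h - g) = (g <= h).
Proof.
apply/idP/idP => [/(leD g)|/(leD (- g))]; first by rewrite add0r subrK.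
by rewrite subrr.
Qed.

Lemma group_subr_gt0 g h : (0 < h - g) = (g < h).
Proof. by rewrite !lt_neqAle group_subr_ge0 eq_sym subr_eq0 eq_sym. Qed.

(** If the multiples of [e] were bounded, then subtracting [e] from a bound
    would give another bound, so no bound could be the best one.  The family is
    negated here because completeness speaks of infima. *)
Lemma conditionally_complete_archimedean :
  conditionally_complete G -> archimedean_group G.
Proof.
move=> cplG g e e0; apply: contrapT => /forallNP unbounded.
have [||m [lbm glbm]] := cplG (range (fun n => - (e *+ n))).
- by exists 0, 0%N; rewrite // mulr0n oppr0.
- exists (- g) => _ [n _ <-]; rewrite -group_subr_ge0 opprK addrC group_subr_ge0.
  exact/ltW/group_leP/unbounded.
have /glbm : lbound (range (fun n => - (e *+ n))) (m + e).
  move=> _ [n _ <-]; have /(leD e) := lbm _ (imageT _ n.+1).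
  by rewrite mulrSr opprD subrK.
rewrite -group_subr_ge0 opprD addNKr -sub0r group_subr_ge0 => /le_lt_trans.
by move=> /(_ _ e0); rewrite ltxx.
Qed.

Lemma group_lerMz e (i j : int) : 0 < e -> (e *~ i <= e *~ j) = (i <= j).
Proof.
move=> e0; have pos (k : int) : 0 <= k -> 0 <= e *~ k.
  case: k => // n _; rewrite -pmulrn -[0](mul0rn _ n).
  exact/group_lerMn/ltW.
have posS (n : nat) : 0 < e *+ n.+1.
  rewrite mulrS; apply: (lt_le_trans e0).
  by rewrite -[leLHS]addr0 group_lerD// pmulrn pos.
rewrite -group_subr_ge0 -mulrzBr -subr_ge0.
apply/idP/idP => [|/pos//]; case: (j - i) => // n.
rewrite NegzE mulrNz -sub0r group_subr_ge0 -pmulrn.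
by move=> /(lt_le_trans (posS n)); rewrite ltxx.
Qed.

Hypothesis archG : archimedean_group G.

Lemma group_floor e h : 0 < e -> exists i : int, e *~ i <= h <= e *~ (i + 1).
Proof.
move=> e0; have [M hM] := archG (- h) e0.
have h'0 : 0 <= h + e *+ M by rewrite -[h]opprK addrC group_subr_ge0.
have [N hN] := archG (h + e *+ M) e0.
have exP : exists n, h + e *+ M <= e *+ n.+1.
  exists N; apply: (le_trans hN); rewrite !pmulrn group_lerMz//; lia.
(* [h + M * e] is nonnegative, so its floor is found among the naturals. *)
pose n := ex_minn exP; exists (n%:Z - M%:Z).
have shift i : e *~ (i - M%:Z) = e *~ i - e *+ M by rewrite mulrzBr.
rewrite addrAC !shift -[h in X in X && _](addrK (e *+ M)).
rewrite -[h in X in _ && X](addrK (e *+ M)).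
rewrite /n; case: ex_minnP => k kP kmin; apply/andP; split; apply: leD.
  case: k {kP} kmin => // k kmin; apply/ltW/group_leP => /kmin; lia.
by rewrite -[k%:Z + 1]PoszD addn1 -pmulrn.
Qed.

Variable R : realType.

(** The embedding compares [g] with a fixed positive unit [e]: its value is the
    Dedekind cut of the fractions [i / n] with [i * e <= n * g]. *)
Definition hoelder_map e g : R :=
  sup [set q | exists (i : int) (n : nat),
    q = i%:~R / n.+1%:R /\ e *~ i <= g *+ n.+1].

Lemma hoelder_cut e g (i j : int) (n k : nat) : 0 < e ->
  e *~ i <= g *+ n.+1 -> g *+ k.+1 <= e *~ j ->
  i%:~R / n.+1%:R <= j%:~R / k.+1%:R :> R.
Proof.
move=> e0 /(group_lerMn k.+1) ig /(group_lerMn n.+1) gj.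
rewrite ler_pdivrMr ?ltr0n// mulrAC ler_pdivlMr ?ltr0n//.
rewrite !pmulrn -!intrM ler_int -(group_lerMz _ _ e0) !mulrzA -!pmulrn.
by apply: (le_trans ig); rewrite -mulrnA mulnC mulrnA.
Qed.

Lemma hoelder_map_ge e g (i : int) (n : nat) : 0 < e ->
  e *~ i <= g *+ n.+1 -> i%:~R / n.+1%:R <= hoelder_map e g.
Proof.
move=> e0 ig; apply: ub_le_sup; last by exists i, n.
have [j /andP[_ gj]] := group_floor g e0.
exists ((j + 1)%:~R / 1%:R) => _ [i' [n' [-> ig']]].
by apply: hoelder_cut ig' _ => //; rewrite mulr1n.
Qed.

Lemma hoelder_map_le e g (i : int) (n : nat) : 0 < e ->
  g *+ n.+1 <= e *~ i -> hoelder_map e g <= i%:~R / n.+1%:R.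
Proof.
move=> e0 gi; apply: ge_sup.
  have [j /andP[jg _]] := group_floor g e0.
  by exists (j%:~R / 1%:R), j, 0%N; rewrite mulr1n.
by move=> _ [j [k [-> jg]]]; exact: hoelder_cut gi.
Qed.

Lemma hoelder_map_approx e g (n : nat) : 0 < e -> exists i : int,
  e *~ i <= g *+ n.+1 <= e *~ (i + 1) /\
  i%:~R / n.+1%:R <= hoelder_map e g <= (i + 1)%:~R / n.+1%:R.
Proof.
move=> e0; have [i ig] := group_floor (g *+ n.+1) e0; exists i; split => //.
by case/andP: ig => ig gi; rewrite hoelder_map_ge// hoelder_map_le.
Qed.

(** Approximating [g] and [h] with denominator [n] puts both the image of
    [g - h] and the difference of the images in a common interval of length
    [2 / n], for every [n]. *)
Lemma hoelder_map_sub e : 0 < e -> zmod_morphism (hoelder_map e).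
Proof.
move=> e0 g h; apply/eqP; rewrite -subr_eq0 -normr_le0 leNgt.
apply/negP => /divr_gt0 /(_ (ltr0n R 2)) /ltr_add_invr[n]; rewrite add0r => lt_n.
have [i [/andP[ig gi] /andP[ig' gi']]] := hoelder_map_approx g n e0.
have [j [/andP[jh hj] /andP[jh' hj']]] := hoelder_map_approx h n e0.
have lo : e *~ (i - (j + 1)) <= (g - h) *+ n.+1.
  rewrite mulrzBr mulrnBl group_lerD// -group_subr_ge0 opprK addrC.
  by rewrite group_subr_ge0.
have hi : (g - h) *+ n.+1 <= e *~ (i + 1 - j).
  rewrite mulrzBr mulrnBl group_lerD// -group_subr_ge0 opprK addrC.
  by rewrite group_subr_ge0.
move: (hoelder_map_ge e0 lo) (hoelder_map_le e0 hi) lt_n ig' gi' jh' hj'.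
rewrite !rmorphB !rmorphD /= !mulrBl !mulrDl !mul1r.
set c := n.+1%:R^-1; move: (i%:~R / _) (j%:~R / _) => p q.
move: (hoelder_map e (g - h)) (hoelder_map e g) (hoelder_map e h) => a b d.
move=> pqa apq; rewrite ltr_pdivlMr// => /lt_geF /negP big pb bp qd dq.
by apply: big; rewrite ler_norml; apply/andP; split; lra.
Qed.

Lemma hoelder_map_mono e : 0 < e -> {mono hoelder_map e : g h / g <= h}.
Proof.
move=> e0 g h; rewrite -[LHS]subr_ge0 -[RHS]group_subr_ge0 -hoelder_map_sub//.
move: (h - g) => {g h} g; apply/idP/idP => [|g0]; last first.
  by rewrite -[0](mul0r (1%:R^-1)); apply: (@hoelder_map_ge e g 0 0).
apply: contraPP => /group_leP; rewrite -[g < 0]group_subr_gt0 sub0r => g0.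
have [n en] := archG e g0.
apply/negP; rewrite -ltNge.
apply: (@le_lt_trans _ _ ((-1)%:~R / n.+1%:R)); last first.
  by rewrite rmorphN1 mulN1r oppr_lt0 invr_gt0 ltr0n.
apply: hoelder_map_le => //; rewrite mulrNz -group_subr_ge0 addrC -mulNrn.
rewrite -[e *~ 1]/e group_subr_ge0 mulrSr; apply: (le_trans en).
by rewrite -[leLHS]addr0 group_lerD// ltW.
Qed.

(** Hoelder's theorem.  A trivial group has no positive unit to measure with,
    hence the case distinction. *)
Theorem hoelder_embedding :
  exists phi : {additive G -> R}, {mono phi : g h / g <= h}.
Proof.
have [[e e0]|no_pos] := pselect (exists e : G, 0 < e).
  pose f : {additive G -> R} := HB.pack (hoelder_map e)
    (GRing.isZmodMorphism.Build G R (hoelder_map e) (hoelder_map_sub e0)).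
  by exists f; exact: hoelder_map_mono.
have le0 g h : g <= h.
  apply: contrapT => /group_leP; rewrite -group_subr_gt0 => ?.
  by apply: no_pos; exists (g - h).
by exists (\0 : {additive G -> R}) => g h; rewrite le0 lexx.
Qed.

End OrderedGroup.

(** * Greatest common divisors of ideals *)

Section Ideals.
Variable D : idomainType.
Implicit Types (I A B : set D) (x y a d : D).
Local Notation tofrac := (@FracField.tofrac D).

Definition multiples d : set D := [set x | exists c, x = c * d].

Definition is_gcd I a : Prop :=
  I `<=` multiples a /\ forall d, I `<=` multiples d -> multiples d a.

Definition ideals_have_gcd : Prop :=
  forall I, ideal I -> nonzero I -> exists a, is_gcd I a.

Lemma ideal_sum I n (f : 'I_n -> D) :
  ideal I -> (forall i, I (f i)) -> I (\sum_(i < n) f i).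
Proof. by move=> [I0 ID _] If; elim/big_ind: _. Qed.

Lemma multiples_ideal d : ideal (multiples d).
Proof.
split=> [|_ _ [a ->] [b ->]|a _ [b ->]]; first by exists 0; rewrite mul0r.
  by exists (a + b); rewrite mulrDl.
by exists (a * b); rewrite mulrA.
Qed.

Lemma colon_ideal I d : ideal I -> ideal [set x | I (x * d)].
Proof.
move=> [I0 ID IM]; split=> /= [|x y xI yI|a x xI]; first by rewrite mul0r.
  by rewrite mulrDl; exact: ID.
by rewrite -mulrA; exact: IM.
Qed.

Lemma ideal_mul_mem (T : nzRingType) (A B : set T) (a b : T) :
  A a -> B b -> ideal_mul A B (a * b).
Proof.
by move=> Aa Bb; exists 1%N, (fun=> a), (fun=> b); split=> //; rewrite big_ord1.
Qed.

Lemma ideal_mul_subset A B I : ideal I ->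
  (forall a b, A a -> B b -> I (a * b)) -> ideal_mul A B `<=` I.
Proof.
move=> idI ABI _ [n [a [b [Aa Bb ->]]]].
by apply: ideal_sum => // i; exact: ABI.
Qed.

Lemma ideal_mulC A B : ideal_mul A B = ideal_mul B A.
Proof.
suff sub A' B' : ideal_mul A' B' `<=` ideal_mul B' A' by apply/seteqP; split.
move=> _ [n [a [b [Aa Bb ->]]]]; exists n, b, a; split=> //.
by apply: eq_bigr => i _; rewrite mulrC.
Qed.

Lemma ideal_mulT I : ideal I -> I = ideal_mul I setT.
Proof.
move=> idI; apply/seteqP; split=> [x Ix|].
  by rewrite -[x]mulr1; exact: ideal_mul_mem.
apply: ideal_mul_subset => // a b Ia _.
by rewrite mulrC; case: idI => _ _; exact.
Qed.

Lemma ideal_mul_multiples I d : ideal I -> I `<=` multiples d ->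
  I = ideal_mul (multiples d) [set x | I (x * d)].
Proof.
move=> idI Id; apply/seteqP; split=> [x Ix|].
  have [c xE] := Id x Ix; rewrite xE mulrC; apply: ideal_mul_mem => /=.
    by exists 1; rewrite mul1r.
  by rewrite -xE.
apply: ideal_mul_subset => // _ x [c ->] /= Ixd.
by rewrite mulrAC -mulrA; case: idI => _ _; exact.
Qed.

Lemma base_sum n (f : 'I_n -> {fraction D}) :
  (forall i, base (f i)) -> base (\sum_(i < n) f i).
Proof.
move=> bf; elim/big_ind: _ => //; first by exists 0; rewrite ?tofrac0.
by move=> _ _ [a _ <-] [b _ <-]; exists (a + b); rewrite ?rmorphD.
Qed.

Lemma baseF d : base d%:F. Proof. by exists d. Qed.

Lemma base_div x y : y != 0 -> base (x%:F / y%:F) <-> multiples y x.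
Proof.
rewrite -tofrac_eq0 => y0; split=> [[c _ cE]|[c ->]].
  by exists c; apply/eqP; rewrite -tofrac_eq rmorphM /= cE divfK.
by rewrite rmorphM /= mulfK //; exact: baseF.
Qed.

(** * Greatest common divisors yield sharpness *)

Hypothesis Dval : valuation_domain D.

Lemma multiples_total x y : multiples x y \/ multiples y x.
Proof.
have [->|x0] := eqVneq x 0; first by right; exists 0; rewrite mul0r.
have [->|y0] := eqVneq y 0; first by left; exists 0; rewrite mul0r.
have yx0 : y%:F / x%:F != 0 by rewrite mulf_neq0 ?invr_eq0 ?tofrac_eq0.
have [h|h] := Dval yx0; first by left; apply/base_div.
by right; apply/base_div; rewrite // -invf_div.
Qed.

(** When [A] is not inside [I], one factor can be taken principal.  Let [a] be
    the greatest common divisor of [A].  If [a * B] lies in [I], then [a]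
    generates the first factor.  Otherwise [a * b] is outside [I] for some [b]
    in [B], and such a [b] divides all of [B], so it generates the second
    factor: if [b = c * b'] with [b'] in [B], the elements of [A * b'], which
    lie in [I], are multiples of [a * b], so [a * c] divides all of [A], hence
    [a], and [c] is a unit. *)
Lemma gcd_sharp : ideals_have_gcd -> sharp D.
Proof.
move=> gcdD I A B idI idA idB nzI nzA nzB AB_I.
have [AI|nAI] := pselect (A `<=` I).
  by exists I, setT; split=> //; exact: ideal_mulT.
have IA : I `<=` A.
  have [x [Ax nIx]] := nonsubset nAI.
  move=> y Iy; have [[c ->]|[c xE]] := multiples_total x y.
    by case: idA => _ _; exact.
  by case: nIx; rewrite xE; case: idI => _ _; exact.
have [a [Aa gcda]] := gcdD A idA nzA.
have [aBI|naBI] := pselect (forall b, B b -> I (b * a)).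
  exists (multiples a), [set x | I (x * a)]; split=> //.
  - exact: multiples_ideal.
  - exact: colon_ideal.
  - by apply: ideal_mul_multiples => // x /IA/Aa.
have /existsNP[b /not_implyP[Bb nIba]] := naBI.
have I_ba : I `<=` multiples (b * a).
  move=> x Ix; have [//|[c baE]] := multiples_total (b * a) x.
  by case: nIba; rewrite baE; case: idI => _ _; exact.
have nzb : b != 0.
  by apply: contra_not_neq nIba => ->; rewrite mul0r; case: idI.
have nza : a != 0.
  by apply: contra_not_neq nIba => ->; rewrite mulr0; case: idI.
exists [set x | I (x * b)], (multiples b); split=> //.
- exact: colon_ideal.
- exact: multiples_ideal.
- by move=> x Ax; apply: AB_I; exact: ideal_mul_mem.
- move=> b' Bb'; have [//|[c bE]] := multiples_total b b'.
  have nzb' : b' != 0 by apply: contra_neq nzb => b'0; rewrite bE b'0 mulr0.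
  have [x Ax|e aE] := gcda (c * a).
    have /I_ba[e xb'E] : I (x * b') by apply: AB_I; exact: ideal_mul_mem.
    exists e; apply: (mulIf nzb'); rewrite xb'E bE; ring.
  exists e; apply: (mulIf nza); rewrite bE [LHS]mulrC {1}aE; ring.
- rewrite ideal_mulC; apply: ideal_mul_multiples => // x /I_ba[c ->].
  by exists (c * a); ring.
Qed.

End Ideals.

(** * Sharpness and divisorial closures *)

Section PseudoDedekind.
Variable D : idomainType.
Implicit Types (I A B : set D) (x y a d : D).
Local Notation tofrac := (@FracField.tofrac D).

(** For [x] in [I], the ideal [x I^-1] satisfies [I * (x I^-1) <= xD]; a sharp
    factorization [xD = A' * B'] with [I <= A'] and [x I^-1 <= B'] then pins
    down [A'] as the divisorial closure of [I], with inverse [B' / x]. *)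
Theorem sharp_pseudo_Dedekind : sharp D -> pseudo_Dedekind D.
Proof.
move=> shD I idI [x Ix x0].
have xF0 : x%:F != 0 by rewrite tofrac_eq0.
pose B := [set y | frac_inv (tofrac @` I) (y%:F / x%:F)].
have idB : ideal B.
  split=> [z _|y z By Bz w Iw|a y By w Iw].
  - by rewrite rmorph0 !mul0r; exists 0; rewrite ?rmorph0.
  - rewrite rmorphD !mulrDl.
    have [[c _ <-] [d _ <-]] := (By w Iw, Bz w Iw).
    by exists (c + d); rewrite ?rmorphD.
  - by rewrite rmorphM -!mulrA; apply: baseM; [exact: baseF|rewrite mulrA; exact: By].
have nzB : nonzero B.
  by exists x => // _ [i Ii <-]; rewrite divff// mul1r; exact: baseF.
have IB_x : ideal_mul I B `<=` multiples x.
  apply: ideal_mul_subset; first exact: multiples_ideal.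
  move=> i y Ii By; apply/base_div => //.
  by rewrite rmorphM /= -mulrA mulrC; exact: By (imageP tofrac Ii).
have nzI : nonzero I by exists x.
have nzx : nonzero (multiples x) by exists x => //; exists 1; rewrite mul1r.
have [A' [B' [idA' idB' IA' BB' xE]]] :=
  shD _ _ _ (multiples_ideal x) idI idB nzx nzI nzB IB_x.
have A'B'_x a b : A' a -> B' b -> base (a%:F * (b%:F / x%:F)).
  move=> A'a B'b; rewrite mulrA -rmorphM; apply/base_div => //.
  by rewrite xE; exact: ideal_mul_mem.
have closE : v_closure (tofrac @` I) = tofrac @` A'.
  apply/seteqP; split=> [z zI|_ [a A'a <-] w wI].
    have : multiples x x by exists 1; rewrite mul1r.
    rewrite xE => -[n [a [b [A'a B'b xab]]]].
    have /choice[y yE] : forall i, exists y, y%:F = z * ((b i)%:F / x%:F).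
      move=> i; have [|y _ yE] := zI ((b i)%:F / x%:F); last by exists y.
      by move=> _ [j Ij <-]; rewrite mulrC; apply: A'B'_x => //; exact: IA'.
    exists (\sum_(i < n) y i * a i).
      by apply: ideal_sum => // i; case: idA' => _ _; exact.
    rewrite rmorph_sum /=.
    under eq_bigr => i _ do rewrite rmorphM /= yE.
    rewrite -[RHS]mulr1 -(divff xF0) [X in _ = z * (X%:F / _)]xab.
    rewrite rmorph_sum mulr_suml mulr_sumr; apply: eq_bigr => i _.
    by rewrite rmorphM /= -mulrA; congr (_ * _); rewrite mulrC mulrA.
  have [y _ yE] := wI _ (imageP tofrac Ix).
  have wE : w = y%:F / x%:F by rewrite yE mulfK.
  by rewrite wE; apply: A'B'_x => //; apply: BB'; rewrite /B /= -wE.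
exists [set b%:F / x%:F | b in B'].
  case: idB' => B'0 B'D B'M; split.
  - by exists 0; rewrite // rmorph0 mul0r.
  - move=> _ _ [b Bb <-] [c Bc <-]; exists (b + c); first exact: B'D.
    by rewrite rmorphD mulrDl.
  - move=> _ _ [a _ <-] [b Bb <-]; exists (a * b); first exact: B'M.
    by rewrite rmorphM mulrA.
  - by exists x => // _ [b _ <-]; rewrite mulrC divfK//; exact: baseF.
rewrite closE; apply/seteqP; split=> [_ [n [a [b [Aa Bb ->]]]]|_ [c _ <-]].
  apply: base_sum => i; have [[u Au <-] [v Bv <-]] := (Aa i, Bb i).
  exact: A'B'_x.
have : multiples x (c * x) by exists c.
rewrite xE => -[n [a [b [A'a B'b cxE]]]].
exists n, (fun i => (a i)%:F), (fun i => (b i)%:F / x%:F); split.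
- by move=> i; exists (a i).
- by move=> i; exists (b i).
rewrite -[LHS](mulfK xF0) -rmorphM cxE rmorph_sum mulr_suml.
by apply: eq_bigr => i _; rewrite rmorphM mulrA.
Qed.

Hypothesis Dval : valuation_domain D.

Lemma valuation_local x y : x + y \is a GRing.unit ->
  x \is a GRing.unit \/ y \is a GRing.unit.
Proof.
have [[c ->]|[c ->]] := multiples_total Dval x y.
  by rewrite -[x in x + _]mul1r -mulrDl unitrM => /andP[_]; left.
by rewrite -[y in _ + y]mul1r -mulrDl unitrM => /andP[_]; right.
Qed.

(** A valuation domain is local, so one term of a sum [1 = \sum_i a_i * b_i]
    is a unit and its [a_i] generates the whole ideal. *)
Lemma invertible_principal (J : set {fraction D}) : invertible J ->
  exists2 a, J a & forall z, J z -> exists2 c, base c & z = c * a.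
Proof.
move=> [J' _ JJ']; have : base (1 : {fraction D}) by exact: base1.
rewrite -[X in X _]JJ' => -[n [a [b [Ja Jb sum1]]]].
have JbJ z i : J z -> base (z * b i).
  by move=> Jz; rewrite -JJ'; exact: ideal_mul_mem.
have /choice[f fE] : forall i, exists f, f%:F = a i * b i.
  by move=> i; have [f _ fE] := JbJ _ i (Ja i); exists f.
have [i fu] : exists i, f i \is a GRing.unit.
  apply: contrapT => /forallNP nofu.
  suff : ~ (\sum_(i < n) f i \is a GRing.unit).
    have -> : \sum_(i < n) f i = 1; last by rewrite unitr1.
    apply/eqP; rewrite -tofrac_eq rmorph_sum rmorph1 sum1.
    by apply/eqP/eq_bigr => i _; exact: fE.
  elim/big_ind: _ => //; first by rewrite unitr0.
  by move=> x y nx ny /valuation_local[].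
exists (a i) => // z Jz; exists (z * b i * ((f i)^-1)%:F).
  by apply: baseM; [exact: JbJ|exact: baseF].
have fiF : (f i)%:F * ((f i)^-1)%:F = 1 by rewrite -rmorphM divrr// rmorph1.
by rewrite -[LHS]mulr1 -fiF fE; ring.
Qed.

Lemma pseudo_Dedekind_gcd : pseudo_Dedekind D -> ideals_have_gcd D.
Proof.
move=> pD I idI [x Ix x0].
have [|a aI aP] := invertible_principal (pD I idI _); first by exists x.
have [d _ dE] : base a.
  rewrite -[a]mulr1; apply: aI => _ [i Ii <-]; rewrite mul1r; exact: baseF.
exists d; split=> [i Ii|k Ik].
  have [w|_ [c _ <-] iE] := aP i%:F.
    by move=> wI; rewrite mulrC; apply: wI; exists i.
  by exists c; apply/eqP; rewrite -tofrac_eq iE -dE -rmorphM.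
have k0 : k != 0.
  by apply: contra_neq x0 => k0; have [c ->] := Ik x Ix; rewrite k0 mulr0.
apply/base_div => //; rewrite dE; apply: aI => _ [i Ii <-].
by rewrite mulrC; apply/base_div => //; exact: Ik.
Qed.

End PseudoDedekind.

(** * The value group *)

Section ValueGroup.
Variable D : idomainType.
Hypothesis Dval : valuation_domain D.
Implicit Types (I : set D) (x y : {fraction D}) (g h : value_group D).

(** Totalized at [0], where the default is the value of [1]. *)
Definition value x : value_group D :=
  \pi_(value_group D)%qT (insubd (fu1 D) x).

Lemma val_insubd_fu1 x : x != 0 -> val (insubd (fu1 D) x) = x.
Proof. by move=> x0; rewrite insubdK. Qed.

Lemma value_le x y : x != 0 -> y != 0 ->
  (value x <= value y) <-> base (y / x).
Proof.
move=> x0 y0; rewrite value_group_leE !val_insubd_fu1//.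
by split=> /asboolP.
Qed.

Lemma valueM x y : x != 0 -> y != 0 -> value (x * y) = value x + value y.
Proof.
move=> x0 y0; rewrite /value value_group_addE; congr (\pi_(_)%qT _).
by apply: val_inj; rewrite /= !val_insubd_fu1// mulf_neq0.
Qed.

Lemma value1 : value 1 = 0.
Proof.
by apply: (addrI (value 1)); rewrite -valueM ?oner_neq0// mulr1 addr0.
Qed.

Lemma valueX x n : x != 0 -> value (x ^+ n) = value x *+ n.
Proof.
move=> x0; elim: n => [|n IHn]; first by rewrite expr0 value1 mulr0n.
by rewrite exprS valueM ?expf_neq0// IHn mulrS.
Qed.

Lemma value_surj g : exists2 x, x != 0 & value x = g.
Proof.
elim/quotW: g => u; exists (val u); first exact: fu_neq0.
by congr (\pi_(_)%qT _); apply: val_inj; rewrite /= val_insubd_fu1 ?fu_neq0.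
Qed.

Lemma value_ge0 x : x != 0 -> 0 <= value x <-> base x.
Proof. by move=> x0; rewrite -value1 value_le ?oner_neq0// divr1. Qed.

Lemma value_le_multiples (a d : D) : a != 0 -> d != 0 ->
  value a%:F <= value d%:F <-> multiples a d.
Proof. by move=> a0 d0; rewrite value_le ?tofrac_eq0// base_div. Qed.

Let leVD := @value_group_leD D.
Let V_total := (value_group_total D).1 Dval.

Lemma complete_gcd :
  conditionally_complete (value_group D) -> ideals_have_gcd D.
Proof.
move=> cplV I idI [x0 Ix0 nzx0].
pose S := [set value x%:F | x in [set x | I x /\ x != 0]].
have S_ge0 : lbound S 0.
  by move=> _ [x [_ nzx] <-]; apply/value_ge0; [rewrite tofrac_eq0|exact: baseF].
have [||m [lbm glbm]] := cplV S; [by exists (value x0%:F), x0|by exists 0|].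
have [k nzk km] := value_surj m.
have /value_ge0[//|a _ ak] : 0 <= value k by rewrite km glbm.
have nza : a != 0 by rewrite -tofrac_eq0 ak.
exists a; split=> [x Ix|d Id].
  have [->|nzx] := eqVneq x 0; first by exists 0; rewrite mul0r.
  by apply/value_le_multiples => //; rewrite ak km; apply: lbm; exists x.
have nzd : d != 0.
  by apply: contra_neq nzx0 => d0; have [c ->] := Id _ Ix0; rewrite d0 mulr0.
apply/value_le_multiples => //; rewrite ak km; apply: glbm => _ [x [Ix nzx] <-].
by apply/value_le_multiples => //; exact: Id.
Qed.

(** A nonempty set of values with lower bound [g] is made nonnegative by
    subtracting [g]; its upward closure is then the value set of an ideal,
    whose greatest common divisor has the infimum as value. *)
Lemma gcd_complete :
  ideals_have_gcd D -> conditionally_complete (value_group D).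
Proof.
move=> gcdD S [s0 Ss0] [g lbg].
pose I := [set x : D | x = 0 \/ exists2 s, S s & s - g <= value x%:F].
have IM (a x : D) : I x -> I (a * x).
  move=> [->|[s Ss sx]]; first by left; rewrite mulr0.
  have [->|nza] := eqVneq a 0; first by left; rewrite mul0r.
  have [->|nzx] := eqVneq x 0; first by left; rewrite mulr0.
  right; exists s => //; apply: (le_trans sx).
  by apply/value_le_multiples; [|rewrite mulf_neq0|exists a].
have idI : ideal I.
  split=> //; first by left.
  move=> x y Ix Iy; have [[c ->]|[c ->]] := multiples_total Dval x y.
    by rewrite -[x in x + _]mul1r -mulrDl; exact: IM.
  by rewrite -[y in _ + y]mul1r -mulrDl; exact: IM.
have valI s : S s -> exists x : D, [/\ I x, x != 0 & value x%:F = s - g].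
  move=> Ss; have [k nzk ks] := value_surj (s - g).
  have /value_ge0[//|x _ xk] : 0 <= value k.
    by rewrite ks group_subr_ge0//; exact: lbg.
  exists x; rewrite -tofrac_eq0 xk ks; split=> //.
  by right; exists s => //; rewrite xk ks.
have [x0 [Ix0 nzx0 _]] := valI _ Ss0.
have [|a [Ia gcda]] := gcdD I idI; first by exists x0.
have nza : a != 0.
  by apply: contra_neq nzx0 => a0; have [c ->] := Ia _ Ix0; rewrite a0 mulr0.
exists (value a%:F + g); split=> [s Ss|h lbh].
  have [x [Ix nzx xs]] := valI s Ss.
  by rewrite -[s](subrK g) -xs leVD//; apply/value_le_multiples => //; exact: Ia.
rewrite -[h](subrK g) leVD//.
have a_ge0 : 0 <= value a%:F.
  by apply/value_ge0; [rewrite tofrac_eq0|exact: baseF].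
have [h_le0|/negP/group_leP h_gt0] := boolP (h - g <= 0); first exact: le_trans a_ge0.
have [k nzk kh] := value_surj (h - g).
have /value_ge0[//|d _ dk] : 0 <= value k by rewrite kh ltW// h_gt0.
have nzd : d != 0 by rewrite -tofrac_eq0 dk.
rewrite -kh -dk; apply/value_le_multiples => //; apply: gcda => x Ix.
have [->|nzx] := eqVneq x 0; first by exists 0; rewrite mul0r.
case: Ix => [x0E|[s Ss sx]]; first by rewrite x0E eqxx in nzx.
apply/value_le_multiples => //; rewrite dk kh; apply: le_trans sx.
by apply: leVD; exact: lbh.
Qed.

Theorem value_group_complete_realP (R : realType) :
  value_group_complete_real R D <-> conditionally_complete (value_group D).
Proof.
split=> [[G [_ cplG [phi [[phiG _ phi_surj] phi_mono]]]] S [s Ss] [g lbg]|cplV].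
  have [|||m [[Gm lbm] glbm]] := cplG (phi @` S).
  - by move=> _ [t _ <-]; exact: phiG.
  - by exists (phi s), s.
  - exists (phi g); split; first exact: phiG.
    by move=> _ [t St <-]; rewrite phi_mono; exact: lbg.
  have [k _ km] := phi_surj _ Gm; exists k; split=> [t St|h lbh].
    by rewrite -phi_mono km; apply: lbm; exists t.
  rewrite -phi_mono km; apply: glbm; split; first exact: phiG.
  by move=> _ [t St <-]; rewrite phi_mono; exact: lbh.
have archV := conditionally_complete_archimedean V_total leVD cplV.
have [phi phi_mono] := hoelder_embedding V_total leVD archV R.
exists (range phi); split.
- split; first by exists 0; rewrite ?raddf0.
  by move=> _ _ [g _ <-] [h _ <-]; exists (g - h); rewrite ?raddfB.
- move=> S SG [_ /[dup] /SG[s _ <-] Ss] [_ [[g _ <-] lbg]].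
  have [||m [lbm glbm]] := cplV (phi @^-1` S).
  + by exists s.
  + by exists g => t St; rewrite -phi_mono; exact: lbg.
  exists (phi m); split.
    split=> // r Sr; have [t _ tr] := SG _ Sr.
    by rewrite -tr phi_mono; apply: lbm; rewrite /= tr.
  move=> _ [[h _ <-] lbh]; rewrite phi_mono; apply: glbm => t St.
  by rewrite -phi_mono; exact: lbh.
- exists phi; split=> //; split=> //.
  by move=> g h _ _ E; apply: le_anti; rewrite -!phi_mono E lexx.
Qed.

(** In a chain [P 0 < P 1 < P 2], take [x <> 0] in [P 1] and [y] in [P 2]
    outside [P 1].  The value of [y] is positive, so some power of [y] is a
    multiple of [x], which puts [y] in [P 1]. *)
Lemma archimedean_krull_dim :
  archimedean_group (value_group D) -> krull_dim_le D 1.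
Proof.
move=> archV m P primeP chainP; rewrite leqNgt; apply/negP => m_gt1.
have [idP0 _ _] := primeP 0%N isT.
have [idP1 _ P1prime] := primeP 1%N (ltnW m_gt1).
have [idP2 P2_1 _] := primeP 2%N m_gt1.
have [_ /nonsubset[x [P1x nP0x]]] := chainP 0%N (ltnW m_gt1).
have [_ /nonsubset[y [P2y nP1y]]] := chainP 1%N m_gt1.
have nzx : x != 0 by apply: contra_not_neq nP0x => ->; case: idP0.
have nzy : y != 0 by apply: contra_not_neq nP1y => ->; case: idP1.
have nzyF : y%:F != 0 by rewrite tofrac_eq0.
have y_gt0 : 0 < value y%:F.
  apply: (group_leP V_total); rewrite -value1 -(tofrac1 D).
  move=> /value_le_multiples[//||c cE]; first exact: oner_neq0.
  by apply: P2_1; rewrite cE; case: idP2 => _ _; exact.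
have [n] := archV (value x%:F) _ y_gt0.
rewrite -valueX// -tofracXn => /value_le_multiples[//||c ynE]; first exact: expf_neq0.
have : P 1%N (y ^+ n) by rewrite ynE; case: idP1 => _ _; exact.
elim: n {ynE} => [P1_1|n IHn]; last by rewrite exprS => /P1prime[].
by apply: nP1y; rewrite -[y]mulr1; case: idP1 => _ _; exact.
Qed.

End ValueGroup.

Theorem proposition6 (R : realType) (D : idomainType)
    (Dval : valuation_domain D) :
  [/\ sharp D <-> pseudo_Dedekind D,
      pseudo_Dedekind D <-> value_group_complete_real R D
    & sharp D -> krull_dim_le D 1].
Proof.
have s_pD := @sharp_pseudo_Dedekind D.
have pD_gcd := pseudo_Dedekind_gcd Dval.
have gcd_s := gcd_sharp Dval.
have gcd_cpl := gcd_complete Dval.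
split.
- by split=> [/s_pD|/pD_gcd/gcd_s].
- rewrite (value_group_complete_realP Dval R).
  by split=> [/pD_gcd/gcd_cpl|/complete_gcd/gcd_s/s_pD].
move=> /s_pD/pD_gcd/gcd_cpl cplV; apply: archimedean_krull_dim => //.
apply: conditionally_complete_archimedean cplV; last exact: value_group_leD.
exact: (value_group_total D).1.
Qed.
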